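(* Let $\mathbf{B}_1\in\mathbb{H}^{r\times s}_{r_1}$, $\mathbf{B}_2\in\mathbb{H}^{q\times s}_{r_2}$, $\mathbf{C}\in\mathbb{H}^{m\times s}$, let $\mathbf{N}=\mathbf{B}_2\mathbf{L}_{B_1}$ with $\operatorname{rank}\mathbf{N}=r_3$, and let $\mathbf{X}_1=\mathbf{C}\mathbf{B}_1^\dagger-\mathbf{C}\mathbf{N}^\dagger\mathbf{B}_2\mathbf{B}_1^\dagger=(x^{(1)}_{ij})\in\mathbb{H}^{m\times r}$ and $\mathbf{X}_2=\mathbf{C}\mathbf{N}^\dagger=(x^{(2)}_{gf})\in\mathbb{H}^{m\times q}$. Let $\mathbf{c}^{(1)}_{i.}$ and $\mathbf{c}^{(2)}_{i.}$ be the $i$th rows of $\mathbf{C}_1=\mathbf{C}\mathbf{B}_1^*$ and $\mathbf{C}_2=\mathbf{C}\mathbf{N}^*$, and $\tilde{\mathbf{b}}^{(2)}_{t.}$ the $t$th row of $\tilde{\mathbf{B}}_2=\mathbf{B}_2\mathbf{B}_1^*$. Then $$x^{(1)}_{ij}=\frac{\sum_{\alpha\in I_{r_1,r}\{j\}}\mathrm{rdet}_j\big((\mathbf{B}_1\mathbf{B}_1^* )_{j.}(\mathbf{c}^{(1)}_{i.})\big)^\alpha_\alpha}{\sum_{\alpha\in I_{r_1,r}}|\mathbf{B}_1\mathbf{B}_1^*|^\alpha_\alpha}-\frac{\sum_{t=1}^q\sum_{\alpha\in I_{r_3,q}\{t\}}\mathrm{rdet}_t\big((\mathbf{N}\mathbf{N}^*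 )_{t.}(\mathbf{c}^{(2)}_{i.})\big)^\alpha_\alpha\sum_{\alpha\in I_{r_1,r}\{j\}}\mathrm{rdet}_j\big((\mathbf{B}_1\mathbf{B}_1^* )_{j.}(\tilde{\mathbf{b}}^{(2)}_{t.})\big)^\alpha_\alpha}{\sum_{\alpha\in I_{r_3,q}}|\mathbf{N}\mathbf{N}^*|^\alpha_\alpha\sum_{\alpha\in I_{r_1,r}}|\mathbf{B}_1\mathbf{B}_1^*|^\alpha_\alpha},$$ $$x^{(2)}_{gf}=\frac{\sum_{\alpha\in I_{r_3,q}\{f\}}\mathrm{rdet}_f\big((\mathbf{N}\mathbf{N}^* )_{f.}(\mathbf{c}^{(2)}_{g.})\big)^\alpha_\alpha}{\sum_{\alpha\in I_{r_3,q}}|\mathbf{N}\mathbf{N}^*|^\alpha_\alpha}.$$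
   Context: $\mathbb{H}$ is the skew field of real quaternions; $\mathbb{H}^{m\times n}$ is the set of $m\times n$ matrices over $\mathbb{H}$ and $\mathbb{H}^{m\times n}_r$ the subset of those of rank $r$. $\mathbf{A}^*$ is the conjugate transpose and $\mathbf{A}^\dagger$ the Moore–Penrose inverse (the unique $\mathbf{X}$ with $\mathbf{AXA}=\mathbf{A}$, $\mathbf{XAX}=\mathbf{X}$, $(\mathbf{AX})^*=\mathbf{AX}$, $(\mathbf{XA})^*=\mathbf{XA}$). $\mathbf{L}_A=\mathbf{I}-\mathbf{A}^\dagger\mathbf{A}$. For a matrix $\mathbf{F}$, $\mathbf{F}_{i.}(\mathbf{b})$ is $\mathbf{F}$ with its $i$th row replaced by the row $\mathbf{b}$. Row determinants: for $\mathbf{F}=(a_{ij})\in\mathbb{H}^{n\times n}$, $\mathrm{rdet}_i\mathbf{F}=\sum_{\sigma\in S_n}(-1)^{n-r}(a_{i\,i_{k_1}}a_{i_{k_1}i_{k_1+1}}\cdots a_{i_{k_1+l_1}i})\cdots(a_{i_{k_r}i_{k_r+1}}\cdots a_{i_{k_r+l_r}i_{k_r}})$, where $\sigma=(i\,i_{k_1}\,i_{k_1+1}\cdots i_{k_1+l_1})(i_{k_2}\cdots i_{k_2+l_2})\cdots(i_{k_r}\cdots i_{k_r+l_r})$ is the decomposition of $\sigma$ into $r$ disjoint cycles (fixed points included) with $i_{k_2}<\cdots<i_{k_r}$ and $i_{k_t}<i_{k_t+s}$ for $t=2,\dots,r$, $s=1,\dots,l_t$. For Hermitian $\mathbf{F}$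 all $\mathrm{rdet}_i\mathbf{F}$ coincide and are real; this value is $\det\mathbf{F}$. Index sets: $L_{k,n}$ is the set of strictly increasing sequences $\alpha=(\alpha_1<\cdots<\alpha_k)$ in $\{1,\dots,n\}$; $I_{k,m}\{i\}=\{\alpha\in L_{k,m}: i\in\alpha\}$; sums over $I_{k,m}$ without braces run over all of $L_{k,m}$. For a square $\mathbf{F}$, $\mathbf{F}^\alpha_\alpha$ is the principal submatrix with rows and columns indexed by $\alpha$; $\mathrm{rdet}_j(\mathbf{G})^\alpha_\alpha$ is the row determinant of the principal submatrix $\mathbf{G}^\alpha_\alpha$ taken at the row coming from index $j$; for Hermitian $\mathbf{F}$, $|\mathbf{F}|^\alpha_\alpha=\det\mathbf{F}^\alpha_\alpha$. *)

(* Defs.v *)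
From HB Require Import structures.
From mathcomp Require Import all_boot all_order all_algebra all_fingroup.
From mathcomp Require Import ring.
From mathcomp Require Import reals.
Set Implicit Arguments. Unset Strict Implicit. Unset Printing Implicit Defensive.
Import Order.TTheory GRing.Theory Num.Theory.
Local Open Scope ring_scope.

(* The quaternion algebra over a commutative ring R: a + b i + c j + d k *)
Record quat (R : Type) := Quat { qa : R; qb : R; qc : R; qd : R }.
Arguments Quat {R}.

Definition quat_to (R : Type) (q : quat R) : R * R * R * R :=
  (qa q, qb q, qc q, qd q).
Definition quat_of (R : Type) (x : R * R * R * R) : quat R :=
  let: (a, b, c, d) := x in Quat a b c d.
Lemma quat_toK (R : Type) : cancel (@quat_to R) (@quat_of R).
Proof. by case. Qed.

HB.instance Definition _ (R : choiceType) :=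
  Choice.copy (quat R) (can_type (@quat_toK R)).

Definition qadd (R : nmodType) (p q : quat R) :=
  Quat (qa p + qa q) (qb p + qb q) (qc p + qc q) (qd p + qd q).
Definition qopp (R : zmodType) (p : quat R) :=
  Quat (- qa p) (- qb p) (- qc p) (- qd p).
Definition qzero (R : nmodType) : quat R := Quat 0 0 0 0.

Lemma qaddA (R : zmodType) : associative (@qadd R).
Proof. by case=> ????; case=> ????; case=> ????; rewrite /qadd /= !addrA. Qed.
Lemma qaddC (R : zmodType) : commutative (@qadd R).
Proof. by case=> ????; case=> ????; rewrite /qadd /= [X in Quat X _ _ _]addrC
  [X in Quat _ X _ _]addrC [X in Quat _ _ X _]addrC [X in Quat _ _ _ X]addrC. Qed.
Lemma qadd0 (R : zmodType) : left_id (@qzero R) (@qadd R).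
Proof. by case=> ????; rewrite /qadd /= !add0r. Qed.
Lemma qaddN (R : zmodType) : left_inverse (@qzero R) (@qopp R) (@qadd R).
Proof. by case=> ????; rewrite /qadd /= !addNr. Qed.

HB.instance Definition _ (R : zmodType) :=
  GRing.isZmodule.Build (quat R) (@qaddA R) (@qaddC R) (@qadd0 R) (@qaddN R).

Definition qmul (R : nzRingType) (p q : quat R) : quat R :=
  Quat (qa p * qa q - qb p * qb q - qc p * qc q - qd p * qd q)
       (qa p * qb q + qb p * qa q + qc p * qd q - qd p * qc q)
       (qa p * qc q - qb p * qd q + qc p * qa q + qd p * qb q)
       (qa p * qd q + qb p * qc q - qc p * qb q + qd p * qa q).
Definition qone (R : nzRingType) : quat R := Quat 1 0 0 0.

Lemma qmulA (R : comNzRingType) : associative (@qmul R).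
Proof. by case=> ????; case=> ????; case=> ????; rewrite /qmul /=; congr Quat; ring. Qed.
Lemma qmul1 (R : comNzRingType) : left_id (@qone R) (@qmul R).
Proof. by case=> ????; rewrite /qmul /=; congr Quat; ring. Qed.
Lemma qmulr1 (R : comNzRingType) : right_id (@qone R) (@qmul R).
Proof. by case=> ????; rewrite /qmul /=; congr Quat; ring. Qed.
Lemma qmulDl (R : comNzRingType) : left_distributive (@qmul R) (@qadd R).
Proof.
by case=> ????; case=> ????; case=> ????; rewrite /qmul /= /qadd /=; congr Quat; ring.
Qed.
Lemma qmulDr (R : comNzRingType) : right_distributive (@qmul R) (@qadd R).
Proof.
by case=> ????; case=> ????; case=> ????; rewrite /qmul /= /qadd /=; congr Quat; ring.
Qed.
Lemma qone_neq0 (R : comNzRingType) : @qone R != 0.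
Proof. by apply/eqP => -[] /eqP; rewrite oner_eq0. Qed.

HB.instance Definition _ (R : comNzRingType) :=
  GRing.Zmodule_isNzRing.Build (quat R) (@qmulA R) (@qmul1 R) (@qmulr1 R)
    (@qmulDl R) (@qmulDr R) (@qone_neq0 R).

Notation H R := (quat (R : realType)).

Definition qconj (R : zmodType) (q : quat R) := Quat (qa q) (- qb q) (- qc q) (- qd q).
Definition qnorm2 (R : nzRingType) (q : quat R) :=
  qa q ^+ 2 + qb q ^+ 2 + qc q ^+ 2 + qd q ^+ 2.
Definition qinv (R : fieldType) (q : quat R) : quat R :=
  let n := (qnorm2 q)^-1 in
  Quat (qa (qconj q) * n) (qb (qconj q) * n) (qc (qconj q) * n) (qd (qconj q) * n).

Definition ctr (R : realType) m n (A : 'M[H R]_(m, n)) : 'M[H R]_(n, m) :=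
  map_mx (@qconj R) A^T.

Definition is_MP (R : realType) m n (A : 'M[H R]_(m, n)) (X : 'M[H R]_(n, m)) : Prop :=
  [/\ A *m X *m A = A, X *m A *m X = X,
      ctr (A *m X) = A *m X & ctr (X *m A) = X *m A].

Definition LA (R : realType) m n (Ad : 'M[H R]_(n, m)) (A : 'M[H R]_(m, n)) : 'M[H R]_n :=
  1%:M - Ad *m A.

(* Rank over the skew field H: the maximal number of right-linearly
   independent columns (= maximal number of left-linearly independent rows). *)
Definition cols_indep (R : realType) m n (A : 'M[H R]_(m, n)) (S : {set 'I_n}) : Prop :=
  forall v : 'cV[H R]_n, (forall j, j \notin S -> v j 0 = 0) ->
    A *m v = 0 -> v = 0.
Definition has_rank (R : realType) m n (A : 'M[H R]_(m, n)) (k : nat) : Prop :=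
  (exists S : {set 'I_n}, #|S| = k /\ cols_indep A S) /\
  (forall S : {set 'I_n}, cols_indep A S -> (#|S| <= k)%N).

Definition row_repl (R : Type) m n (F : 'M[R]_(m, n)) (i : 'I_m) (b : 'rV[R]_n) :
  'M[R]_(m, n) := \matrix_(a, c) if a == i then b 0 c else F a c.

Definition cyc_prod (R : realType) k (F : 'M[H R]_k) (s : {perm 'I_k}) (x : 'I_k) : H R :=
  \prod_(t < #|porbit s x|) F ((s ^+ t)%g x) ((s ^+ t.+1)%g x).

Definition cyc_head k (s : {perm 'I_k}) (x : 'I_k) : bool :=
  [forall y, (y \in porbit s x) ==> (x <= y)%N].

Definition rsign (R : realType) k (s : {perm 'I_k}) : H R :=
  (-1) ^+ (k - #|porbits s|).

(* rdet_i F: the cycle of i comes first (starting at i), then the other cycles,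
   each starting at its least element, in increasing order of these elements. *)
Definition rdet (R : realType) k (i : 'I_k) (F : 'M[H R]_k) : H R :=
  \sum_(s : {perm 'I_k})
     rsign R s * (cyc_prod F s i *
       \prod_(x < k | cyc_head s x && (x \notin porbit s i)) cyc_prod F s x).

(* det of a Hermitian matrix = rdet_1 (all rdet_i coincide); written for all
   sizes (equals rdet at the first row when k > 0, and 1 when k = 0). *)
Definition hdet (R : realType) k (F : 'M[H R]_k) : H R :=
  \sum_(s : {perm 'I_k})
     rsign R s * \prod_(x < k | cyc_head s x) cyc_prod F s x.

(* alpha in L_{k,n} is represented as a subset of 'I_n of cardinality k;
   its elements in increasing order are enum_val 0 < enum_val 1 < ... *)
Definition psub (R : Type) n (G : 'M[R]_n) (A : {set 'I_n}) : 'M[R]_#|A| :=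
  \matrix_(a, b) G (enum_val a) (enum_val b).

Definition rdet_sub (R : realType) n (G : 'M[H R]_n) (A : {set 'I_n}) (j : 'I_n) : H R :=
  if [pick a : 'I_#|A| | enum_val a == j] is Some a then rdet a (psub G A) else 0.

Definition hminor (R : realType) n (F : 'M[H R]_n) (A : {set 'I_n}) : H R :=
  hdet (psub F A).

(* Main.v *)
Require Import Defs.
From HB Require Import structures.
From mathcomp Require Import all_boot all_order all_algebra all_fingroup.
From mathcomp Require Import ring.
From mathcomp Require Import reals.
Set Implicit Arguments. Unset Strict Implicit. Unset Printing Implicit Defensive.
Import Order.TTheory GRing.Theory Num.Theory.
Local Open Scope ring_scope.

(** Removing sigma(i) from the cycle of i in a permutation sigma gives a recursion for row
    determinants over principal index sets S. For a Hermitian matrix M this recursion, read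
    from both ends of the cycle, yields by induction on S that the cofactors P_S form a
    Hermitian matrix with M_S P_S = det(M_S) I; that the determinants at different rows agree
    follows from (D_i - D_j) P_S(i,j) = 0, after deforming M into a matrix whose off-diagonal
    cofactors do not vanish.

    Let e_k be the sum of the principal minors of order k of M and Q_k the sum of the matrices
    P_S with |S| = k, padded with zeros. Then M Q_k + Q_(k+1) = e_k I. If M = A A* with A of
    rank k, then e_k > 0 and A* Q_(k+1) = 0, and multiplying on the left by the Moore-Penrose
    inverse A^+ gives e_k A^+ = A* Q_k. Both formulas of the theorem are entries of products
    with this identity. *)

(** * Row determinants over principal index sets *)

Lemma sorted_filter_ord n (P : pred 'I_n) :
  sorted (fun x y : 'I_n => (x < y)%N) (filter P (Finite.enum 'I_n)).
Proof.
apply: sorted_filter; first by move=> x y z; apply: ltn_trans.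
have := iota_ltn_sorted 0 n; rewrite -val_enum_ord sorted_map enumT.
by apply: sub_sorted => x y.
Qed.

(** Products over ordinals run in increasing order, so without commutativity it is the factor of the
    least index that splits off on the left. *)
Lemma prod_min_first (Q : pzRingType) n (P : pred 'I_n) (f : 'I_n -> Q) h :
    P h -> (forall x, P x -> (h <= x)%N) ->
  \prod_(x < n | P x) f x = f h * \prod_(x < n | P x && (x != h)) f x.
Proof.
move=> Ph minh.
have srt : sorted (fun x y : 'I_n => (x < y)%N) (filter P (index_enum 'I_n)).
  by rewrite [index_enum _]unlock sorted_filter_ord.
have hP : h \in filter P (index_enum 'I_n) by rewrite mem_filter Ph mem_index_enum.
rewrite -big_filter.
have -> : \prod_(x < n | P x && (x != h)) f x
        = \prod_(x <- filter (predC1 h) (filter P (index_enum 'I_n))) f x.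
  by rewrite -filter_predI big_filter; apply: eq_bigl => x; rewrite /= andbC.
have : all P (filter P (index_enum 'I_n)) by apply: filter_all.
move: srt hP; case: (filter P _) => // a l /= srt hal /andP[Pa _].
have amin : all (fun x : 'I_n => (a < x)%N) l.
  by apply: order_path_min srt => x y z; apply: ltn_trans.
have ah : a = h.
  move: hal; rewrite inE => /orP[/eqP->|/(allP amin)] //.
  by rewrite ltnNge minh.
subst a; rewrite /= eqxx big_cons; congr (_ * _).
apply: congr_big => //; symmetry; apply/all_filterP/allP => x /(allP amin) ax /=.
by apply: contraTneq ax => ->; rewrite ltnn.
Qed.

Section SetDeterminants.
Variables (Q : pzRingType) (n : nat).
Implicit Types (M : 'I_n -> 'I_n -> Q) (S : {set 'I_n}) (s : {perm 'I_n}).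

Definition cycle_prod M s x : Q :=
  \prod_(t < #|porbit s x|) M ((s ^+ t)%g x) ((s ^+ t.+1)%g x).
Definition cycle_tail M s x : Q :=
  \prod_(t < #|porbit s x|.-1) M ((s ^+ t.+1)%g x) ((s ^+ t.+2)%g x).
Definition other_cycles M S s i : Q :=
  \prod_(x < n | [&& x \in S, cyc_head s x & x \notin porbit s i]) cycle_prod M s x.
End SetDeterminants.

(* Row i of M, replaced by b here, enters only as the first factor of the cycle of i. *)
HB.lock Definition rowdet (Q : pzRingType) n (M : 'I_n -> 'I_n -> Q) (S : {set 'I_n}) i
    (b : 'I_n -> Q) : Q :=
  \sum_(s : {perm 'I_n} | perm_on S s)
     (-1) ^+ odd_perm s * (b (s i) * (cycle_tail M s i * other_cycles M S s i)).
(** No row is distinguished: every cycle starts at its least element, as in [hdet], which also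
    covers the empty set. *)
HB.lock Definition setdet (Q : pzRingType) n (M : 'I_n -> 'I_n -> Q) (S : {set 'I_n}) : Q :=
  \sum_(s : {perm 'I_n} | perm_on S s)
     (-1) ^+ odd_perm s * \prod_(x < n | (x \in S) && cyc_head s x) cycle_prod M s x.

Section SetDeterminantTheory.
Variables (Q : pzRingType) (n : nat).
Implicit Types (M : 'I_n -> 'I_n -> Q) (S : {set 'I_n}) (s : {perm 'I_n}).

Lemma rowdetE M S i b : rowdet M S i b =
  \sum_(s : {perm 'I_n} | perm_on S s)
     (-1) ^+ odd_perm s * (b (s i) * (cycle_tail M s i * other_cycles M S s i)).
Proof. by rewrite rowdet.unlock. Qed.

Lemma setdetE M S : setdet M S =
  \sum_(s : {perm 'I_n} | perm_on S s)
     (-1) ^+ odd_perm s * \prod_(x < n | (x \in S) && cyc_head s x) cycle_prod M s x.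
Proof. by rewrite setdet.unlock. Qed.

Lemma cycle_prodE M s x : cycle_prod M s x = M x (s x) * cycle_tail M s x.
Proof.
rewrite /cycle_prod /cycle_tail; case E: #|porbit s x| => [|d].
  by have := card_porbit_neq0 s x; rewrite E.
by rewrite big_ord_recl /= expg0 perm1 expg1.
Qed.

Lemma perm_on_porbit S s i x : perm_on S s -> i \in S -> x \in porbit s i -> x \in S.
Proof.
by move=> Ss iS /porbitP[t ->]; elim: t => [|t IH]; rewrite ?expg0 ?perm1 // expgSr permM perm_closed.
Qed.

Lemma setdet0 M : setdet M set0 = 1.
Proof.
rewrite setdetE (big_pred1 1%g) => [|s].
  by rewrite odd_perm1 mul1r big_pred0 // => x; rewrite inE.
apply/idP/eqP => [s0|->]; last exact: perm_on1.
by apply/permP => x; rewrite perm1 (out_perm s0) ?inE.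
Qed.

(** The least element of S heads its own cycle and that cycle comes first, so both conventions order
    the factors alike. *)
Lemma setdet_rowdet M S h : h \in S -> (forall y, y \in S -> (h <= y)%N) ->
  setdet M S = rowdet M S h (M h).
Proof.
move=> hS minh; rewrite setdetE rowdetE; apply: eq_bigr => s sS; congr (_ * _).
have headh : cyc_head s h.
  by apply/forallP => y; apply/implyP => /(perm_on_porbit sS hS); apply: minh.
rewrite (@prod_min_first _ _ _ _ h) ?hS //; last by move=> x /andP[/minh].
rewrite cycle_prodE mulrA; congr (_ * _); apply: eq_bigl => x.
rewrite -andbA; case xS: (x \in S) => //=; case hx: (cyc_head s x) => //=.
congr (~~ _); apply/eqP/idP => [->|xh]; first exact: porbit_id.
apply/val_inj/eqP; rewrite eqn_leq minh // andbT.
by move/forallP/(_ h): hx; rewrite porbit_sym xh.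
Qed.

Lemma perm_onD1 S i s : perm_on S s -> s i = i -> perm_on (S :\ i) s.
Proof.
move=> /subsetP sS si; apply/subsetP => x xs; rewrite !inE (sS _ xs) andbT.
by apply: contraTneq xs => ->; rewrite inE si eqxx.
Qed.

Lemma perm_onD1W S i s : perm_on (S :\ i) s -> perm_on S s.
Proof. by move=> sS; apply: subset_trans sS (subsetDl _ _). Qed.

Lemma porbit_fix s i : s i = i -> porbit s i = [set i].
Proof.
move=> si; apply/setP => x; rewrite inE; apply/porbitP/eqP => [[t ->]|->].
  exact: permX_fix.
by exists 0%N; rewrite expg0 perm1.
Qed.

(* u is s with the fixed point k inserted after i in the cycle of i. *)
Section Detour.
Variables (s : {perm 'I_n}) (i k : 'I_n).
Hypotheses (sk : s k = k) (ki : k != i).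
Let u : {perm 'I_n} := (tperm i k * s)%g.

Lemma detour_i : u i = k. Proof. by rewrite permM tpermL. Qed.
Lemma detour_k : u k = s i. Proof. by rewrite permM tpermR. Qed.
Lemma detour_out x : x != i -> x != k -> u x = s x.
Proof. by move=> xi xk; rewrite permM tpermD // eq_sym. Qed.

Lemma porbit_neq_fixed x t : x != k -> (s ^+ t)%g x != k.
Proof.
by move=> xk; apply: contra_neq xk => xk; apply: (@perm_inj _ (s ^+ t)%g); rewrite xk permX_fix.
Qed.

(** The detour i -> k -> s i costs one extra step; afterwards both orbits run in parallel until they
    return to i, whence the bound on t. *)
Lemma detourX t : (t < #|porbit s i|)%N -> (u ^+ t.+2)%g i = (s ^+ t.+1)%g i.
Proof.
elim: t => [|t IH] lt.
  by rewrite expgSr permM expg1 detour_i detour_k expg1.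
rewrite expgSr permM IH ?(ltnW lt) // [in RHS]expgSr [RHS]permM detour_out //; last first.
  by apply: porbit_neq_fixed; rewrite eq_sym.
apply/eqP => st; have := @nth_uniq _ i (traject s i #|porbit s i|) t.+1 0.
rewrite size_traject => /(_ lt (ltn_trans (ltn0Sn t) lt) (uniq_traject_porbit s i)).
by rewrite !nth_traject ?(ltn_trans (ltn0Sn t) lt) // -permX st eqxx.
Qed.

Lemma porbit_detour : porbit u i = k |: porbit s i.
Proof.
apply/setP => x; rewrite !inE; apply/idP/orP => [/porbitP[t ->]|[/eqP->|]].
- elim: t => [|t IH]; first by right; rewrite expg0 perm1 porbit_id.
  rewrite expgSr permM; set y := (u ^+ t)%g i in IH *.
  case: IH => [/eqP->|yi]; first by right; rewrite detour_k -[s]expg1 mem_porbit.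
  have [->|neq_yi] := eqVneq y i; first by left; rewrite detour_i.
  have [->|neq_yk] := eqVneq y k; first by right; rewrite detour_k -[s]expg1 mem_porbit.
  right; rewrite detour_out //; case/porbitP: yi => t' ->.
  by rewrite -permM -expgSr mem_porbit.
- by have := mem_porbit u 1 i; rewrite expg1 detour_i.
rewrite (porbit_traject s i) => /trajectP[t]; case: t => [|t] lt ->; first exact: porbit_id.
by rewrite -permX -detourX ?(ltnW lt) // mem_porbit.
Qed.

Lemma porbit_detour_out x : x != k -> x \notin porbit s i ->
  forall t, (u ^+ t)%g x = (s ^+ t)%g x.
Proof.
move=> xk xi; elim=> [|t IH]; first by rewrite !expg0.
rewrite expgSr permM IH expgSr [RHS]permM detour_out ?porbit_neq_fixed //.
apply: contraNneq xi => <-; rewrite porbit_sym; exact: mem_porbit.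
Qed.

Lemma card_porbit_detour : #|porbit u i| = #|porbit s i|.+1.
Proof.
rewrite porbit_detour cardsU1; suff -> : k \notin porbit s i by [].
by rewrite porbit_sym porbit_fix // inE eq_sym.
Qed.

Lemma porbit_eq_detour_out x : x != k -> x \notin porbit s i -> porbit u x = porbit s x.
Proof.
move=> xk xi; apply/setP => y; apply/porbitP/porbitP => -[t ->]; exists t;
  by rewrite porbit_detour_out.
Qed.

Lemma cycle_tail_detour M : cycle_tail M u i = M k (s i) * cycle_tail M s i.
Proof.
rewrite /cycle_tail card_porbit_detour /=.
case E: #|porbit s i| => [|d]; first by have := card_porbit_neq0 s i; rewrite E.
rewrite big_ord_recl !expg1 detour_i; congr (M _ _ * _).
  by rewrite detourX ?E // expg1.
apply: eq_bigr => t _; rewrite !lift0.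
by rewrite !detourX ?E ?ltnS // ltnW.
Qed.

Lemma other_cycles_detour M S : k \in S -> other_cycles M S u i = other_cycles M (S :\ k) s i.
Proof.
move=> kS; rewrite /other_cycles porbit_detour.
have eqP x : [&& x \in S, cyc_head u x & x \notin k |: porbit s i]
           = [&& x \in S :\ k, cyc_head s x & x \notin porbit s i].
  rewrite !inE negb_or; have [->|xk] := eqVneq x k; first by rewrite !andbF.
  case: (x \in S) => //=; have [xi|xi] := boolP (x \in porbit s i); first by rewrite !andbF.
  by rewrite /cyc_head porbit_eq_detour_out.
rewrite (eq_bigl _ _ eqP); apply: eq_bigr => x; rewrite !inE => /and3P[/andP[xk _] _ xi].
by rewrite /cycle_prod porbit_eq_detour_out //; apply: eq_bigr => t _; rewrite !porbit_detour_out.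
Qed.
End Detour.

(* Composing with the transposition (i k) is the bijection from the permutations of S fixing k
   to those sending i to k. *)
Lemma rowdet_rec M S i b : i \in S ->
  rowdet M S i b = b i * setdet M (S :\ i)
                   - \sum_(k in S :\ i) b k * rowdet M (S :\ k) i (M k).
Proof.
move=> iS; rewrite rowdetE (partition_big (fun s => s i) (mem S)) /=; last first.
  by move=> s sS; rewrite perm_closed.
rewrite (bigD1 i) //=; congr (_ + _).
  rewrite setdetE big_distrr /=; apply: eq_big => [s|s /andP[sS /eqP si]].
    apply/andP/idP => [[sS /eqP si]|sS]; first exact: perm_onD1.
    by split; [exact: perm_onD1W sS | rewrite (out_perm sS) ?inE ?eqxx].
  rewrite si [RHS]mulrA (commr_sign (b i)) -mulrA; congr (_ * (_ * _)).
  rewrite /cycle_tail porbit_fix // cards1 big_ord0 mul1r.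
  apply: eq_bigl => x; rewrite porbit_fix // !inE.
  by case: (x == i); case: (x \in S); case: (cyc_head s x).
rewrite -sumrN; apply: eq_big => [k|k /andP[kS ki]]; first by rewrite !inE andbC.
rewrite rowdetE big_distrr -sumrN /= (reindex_inj (mulgI (tperm i k))) /=.
apply: eq_big => [s|s /andP[sS /eqP si]].
  rewrite permM tpermL; apply/andP/idP => [[sS /eqP sk]|sS].
    apply: perm_onD1 => //; rewrite -(mulKg (tperm i k) s) tpermV; apply: perm_onM => //.
    by apply: subset_trans (tperm_on i k) _; apply/subsetP => x; rewrite !inE => /orP[]/eqP->.
  rewrite (out_perm sS) ?inE ?eqxx //; split=> //; apply: perm_onM; last exact: perm_onD1W sS.
  by apply: subset_trans (tperm_on i k) _; apply/subsetP => x; rewrite !inE => /orP[]/eqP->.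
have sk : s k = k by move: si; rewrite permM tpermL.
rewrite si odd_mul_tperm eq_sym ki /= cycle_tail_detour // other_cycles_detour //.
by rewrite signrN mulNr; congr (- _); rewrite [RHS]mulrA (commr_sign (b k)) -!mulrA.
Qed.
End SetDeterminantTheory.

Lemma setdet_min (Q : pzRingType) n (M : 'I_n -> 'I_n -> Q) (S : {set 'I_n}) :
  S != set0 -> exists2 h, (h \in S) && [forall y in S, (h <= y)%N]
                        & setdet M S = rowdet M S h (M h).
Proof.
case/set0Pn => i0 i0S; case: (arg_minnP val i0S) => h hS minh.
exists h; last exact: setdet_rowdet.
by rewrite [h \in S]hS; apply/forall_inP.
Qed.

(** * Increasing reindexing and principal submatrices *)

Section Transport.
Variables (Q : pzRingType) (k n : nat) (f : 'I_k -> 'I_n).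
Hypothesis f_mono : forall x y, (f x <= f y)%N = (x <= y)%N.
Variables (M : 'I_n -> 'I_n -> Q) (M' : 'I_k -> 'I_k -> Q).

Let f_inj : injective f.
Proof.
by move=> x y xy; apply/val_inj/eqP; rewrite eqn_leq -!f_mono xy leqnn.
Qed.

(** The recursion for row determinants involves both kinds of determinant over smaller sets, so one
    induction proves the two claims. Row i of M is overridden by b, whence the first index ranges
    over S :\ i. *)
Lemma det_imset (d : nat) :
     (forall S : {set 'I_k}, #|S| = d -> {in S &, forall x y, M' x y = M (f x) (f y)} ->
        setdet M' S = setdet M (f @: S))
  /\ (forall (S : {set 'I_k}) i b b', #|S| = d -> i \in S ->
        {in S :\ i & S, forall x y, M' x y = M (f x) (f y)} ->
        {in S, forall x, b' x = b (f x)} ->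
        rowdet M' S i b' = rowdet M (f @: S) (f i) b).
Proof.
elim: d => [|d [IHs IHr]].
  split=> [S /cards0_eq-> _|S i b b' /cards0_eq->]; last by rewrite inE.
  by rewrite imset0 !setdet0.
have imD S x : f @: (S :\ x) = f @: S :\ f x.
  apply/setP => y; rewrite !inE; apply/imsetP/andP => [[z]|[yx /imsetP[z zS yz]]].
    by rewrite !inE => /andP[zx zS] ->; rewrite (inj_eq f_inj) zx imset_f.
  by exists z => //; rewrite !inE zS andbT; apply: contraNneq yx => <-; rewrite yz.
have row (S : {set 'I_k}) i b b' : #|S| = d.+1 -> i \in S ->
        {in S :\ i & S, forall x y, M' x y = M (f x) (f y)} ->
        {in S, forall x, b' x = b (f x)} ->
        rowdet M' S i b' = rowdet M (f @: S) (f i) b.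
  move=> cS iS eM eb; rewrite !rowdet_rec ?imset_f // -imD.
  have cD x : x \in S -> #|S :\ x| = d by move=> xS; move: cS; rewrite (cardsD1 x) xS => -[].
  congr (_ - _).
    rewrite eb // IHs ?cD // => x y xS; rewrite !inE => /andP[_ yS]; exact: eM.
  rewrite (big_imset _ (in2W f_inj)) /=; apply: eq_bigr => x; rewrite !inE => /andP[xi xS].
  rewrite eb // -imD; congr (_ * _); apply: IHr.
  - exact: cD.
  - by rewrite !inE eq_sym xi.
  - move=> y z; rewrite !inE => /and3P[yi _ yS] /andP[_ zS].
    by apply: eM; rewrite // !inE yi.
  by move=> y; rewrite !inE => /andP[_ yS]; apply: eM; rewrite // !inE xi.
split=> // S cS eM.
have /(setdet_min M')[h /andP[hS /forall_inP minh] ->] : S != set0.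
  by rewrite -card_gt0 cS.
rewrite (@setdet_rowdet _ _ _ _ (f h)) ?imset_f //; last first.
  by move=> _ /imsetP[y yS ->]; rewrite f_mono minh.
apply: row => // [x y|x xS]; last exact: eM.
by rewrite inE => /andP[_ xS]; apply: eM.
Qed.

Lemma setdet_imset (S : {set 'I_k}) : {in S &, forall x y, M' x y = M (f x) (f y)} ->
  setdet M' S = setdet M (f @: S).
Proof. by have [detE _] := det_imset #|S|; apply: detE. Qed.

Lemma rowdet_imset (S : {set 'I_k}) i b b' : i \in S ->
    {in S :\ i & S, forall x y, M' x y = M (f x) (f y)} ->
    {in S, forall x, b' x = b (f x)} ->
  rowdet M' S i b' = rowdet M (f @: S) (f i) b.
Proof. by have [_ detE] := det_imset #|S|; apply: detE. Qed.
End Transport.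

Lemma leq_enum_val n (A : {set 'I_n}) (x y : 'I_#|A|) :
  (enum_val x <= enum_val y)%N = (x <= y)%N.
Proof.
have lt (a b : 'I_#|A|) : (a < b)%N -> (enum_val a < enum_val b)%N.
  move=> ab; pose x0 : 'I_n := enum_val a; rewrite !(enum_val_nth x0).
  apply: (sorted_ltn_nth _ _ (sorted_filter_ord _)) => //; rewrite ?inE -?cardE ?ltn_ord //.
  by move=> ? ? ?; apply: ltn_trans.
apply/idP/idP; last by rewrite leq_eqVlt => /orP[/eqP/val_inj->//|/lt/ltnW].
by apply: contraTT; rewrite -!ltnNge; apply: lt.
Qed.

Lemma imset_enum_val n (A : {set 'I_n}) : @enum_val _ (mem A) @: [set: 'I_#|A|] = A.
Proof.
apply/setP => x; apply/imsetP/idP => [[a _ ->]|xA]; first exact: enum_valP.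
by exists (enum_rank_in xA x) => //; rewrite enum_rankK_in.
Qed.

Section Link.
Variable R : realType.

(** [odd_perm] is defined by the parity of the number of orbits; the truncated subtraction is
    harmless because there are at most k orbits. *)
Lemma rsignE k (s : {perm 'I_k}) : rsign R s = (-1) ^+ odd_perm s.
Proof.
rewrite /rsign -signr_odd oddB ?card_ord; first by rewrite /odd_perm card_ord.
by apply: leq_trans (leq_imset_card _ _) _; rewrite card_ord.
Qed.

Lemma hdet_setdet k (F : 'M[H R]_k) : hdet F = setdet F setT.
Proof.
rewrite /hdet setdetE; apply: eq_big => [s|s _].
  by symmetry; apply/subsetP => x _; rewrite inE.
by rewrite rsignE; congr (_ * _); apply: eq_bigl => x; rewrite inE.
Qed.

Lemma rdet_rowdet k (F : 'M[H R]_k) i : rdet i F = rowdet F setT i (F i).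
Proof.
rewrite /rdet rowdetE; apply: eq_big => [s|s _].
  by symmetry; apply/subsetP => x _; rewrite inE.
rewrite rsignE; congr (_ * _); rewrite mulrA -cycle_prodE; congr (_ * _).
by apply: eq_bigl => x; rewrite inE.
Qed.

Lemma hminor_setdet n (F : 'M[H R]_n) (A : {set 'I_n}) : hminor F A = setdet F A.
Proof.
rewrite /hminor hdet_setdet (setdet_imset (@leq_enum_val _ A) (M := F)) ?imset_enum_val //.
by move=> x y _ _; rewrite mxE.
Qed.

Lemma rdet_sub_rowdet n (F : 'M[H R]_n) (b : 'rV_n) (A : {set 'I_n}) j : j \in A ->
  rdet_sub (row_repl F j b) A j = rowdet F A j (b 0).
Proof.
(* Since j lies in A, the default value 0 of [rdet_sub] does not occur. *)
move=> jA; rewrite /rdet_sub; case: pickP => [a /eqP aj|]; last first.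
  by move/(_ (enum_rank_in jA j)); rewrite enum_rankK_in ?eqxx.
rewrite rdet_rowdet (rowdet_imset (@leq_enum_val _ A) (M := F) (b := b 0)) ?imset_enum_val ?aj //.
  move=> x y; rewrite !inE andbT => xa _; rewrite !mxE -aj.
  by rewrite (inj_eq enum_val_inj) (negbTE xa).
by move=> x _; rewrite !mxE aj eqxx.
Qed.
End Link.

(** Entry (k, i) of P_S: the coefficient of b k in the row determinant at i with row b, extracted by
    a unit row. *)
HB.lock Definition cof (Q : pzRingType) n (M : 'I_n -> 'I_n -> Q) (S : {set 'I_n}) k i : Q :=
  rowdet M S i (fun l => (l == k)%:R).

Section Cofactors.
Variables (Q : pzRingType) (n : nat).
Implicit Types (M : 'I_n -> 'I_n -> Q) (S : {set 'I_n}).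

Lemma cof_diag M S i : i \in S -> cof M S i i = setdet M (S :\ i).
Proof.
move=> iS; rewrite cof.unlock rowdet_rec // eqxx mul1r big1 ?subr0 // => k.
by rewrite !inE => /andP[/negbTE-> _]; rewrite mul0r.
Qed.

Lemma cof_offdiag M S k i : i \in S -> k \in S -> k != i ->
  cof M S k i = - rowdet M (S :\ k) i (M k).
Proof.
move=> iS kS ki; rewrite cof.unlock rowdet_rec // eq_sym (negbTE ki) mul0r sub0r.
rewrite (bigD1 k) ?inE ?ki //= eqxx mul1r big1 ?addr0 // => l /andP[_ /negbTE->].
by rewrite mul0r.
Qed.

Lemma rowdet_cof M S i b : i \in S ->
  rowdet M S i b = \sum_(k in S) b k * cof M S k i.
Proof.
move=> iS; rewrite rowdet_rec // [in RHS](big_setD1 i) //= cof_diag //; congr (_ + _).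
rewrite -sumrN; apply: eq_bigr => k; rewrite !inE => /andP[ki kS].
by rewrite cof_offdiag // mulrN.
Qed.

(** A unit row at k forces the cycle of i to begin i -> k; deleting k leaves a cycle of i over S :\
    k whose first factor comes from row k. *)
Lemma cof_first_step M S k i : i \in S -> k \in S -> k != i ->
  cof M S k i = - \sum_(l in S :\ k) M k l * cof M (S :\ k) l i.
Proof.
move=> iS kS ki; rewrite cof_offdiag // rowdet_cof //.
by rewrite !inE eq_sym ki.
Qed.

Lemma setdet_cof M S : S != set0 ->
  exists2 h, h \in S & setdet M S = \sum_(k in S) M h k * cof M S k h.
Proof.
by case/(setdet_min M) => h /andP[hS _] ->; exists h; rewrite ?rowdet_cof.
Qed.
End Cofactors.

Section Morphism.
Variables (Q Q' : pzRingType) (f : {rmorphism Q -> Q'}) (n : nat).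
Variables (M : 'I_n -> 'I_n -> Q).

Lemma rmorph_setdet S : f (setdet M S) = setdet (fun i j => f (M i j)) S.
Proof.
rewrite !setdetE rmorph_sum; apply: eq_bigr => s _; rewrite rmorphM rmorph_sign; congr (_ * _).
by rewrite rmorph_prod; apply: eq_bigr => x _; rewrite rmorph_prod.
Qed.

Lemma rmorph_cof S k i : f (cof M S k i) = cof (fun i j => f (M i j)) S k i.
Proof.
rewrite cof.unlock !rowdetE rmorph_sum; apply: eq_bigr => s _.
rewrite !rmorphM rmorph_sign rmorph_nat; congr (_ * (_ * (_ * _))).
  by rewrite rmorph_prod.
by rewrite rmorph_prod; apply: eq_bigr => x _; rewrite rmorph_prod.
Qed.
End Morphism.

Lemma eq_setdet (Q : pzRingType) n (M M' : 'I_n -> 'I_n -> Q) S :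
  M =2 M' -> setdet M S = setdet M' S.
Proof.
move=> eqM; rewrite !setdetE; apply: eq_bigr => s _; congr (_ * _).
by apply: eq_bigr => x _; apply: eq_bigr => t _.
Qed.

Lemma eq_cof (Q : pzRingType) n (M M' : 'I_n -> 'I_n -> Q) S k i :
  M =2 M' -> cof M S k i = cof M' S k i.
Proof.
move=> eqM; rewrite cof.unlock !rowdetE; apply: eq_bigr => s _; congr (_ * (_ * (_ * _))).
  by apply: eq_bigr => t _.
by apply: eq_bigr => x _; apply: eq_bigr => t _.
Qed.

(** This matrix is the starting point of the deformation. Its determinants and cofactors determine
    each other at smaller sizes, hence the joint induction. *)
Lemma cof_one_plus_ones (Q : pzRingType) n (M : 'I_n -> 'I_n -> Q) (S : {set 'I_n}) :
    (forall i j, M i j = 1 + (i == j)%:R) ->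
  setdet M S = #|S|.+1%:R /\ {in S &, forall i j, i != j -> cof M S i j = -1}.
Proof.
move=> ME; have [d] := ubnP #|S|; elim: d S => // d IH S; rewrite ltnS => leS.
have cD (T : {set 'I_n}) x : x \in T -> #|T| = #|T :\ x|.+1.
  by move=> xT; rewrite (cardsD1 x) xT.
have sumN1 (T : {set 'I_n}) : \sum_(l in T) (-1) = - #|T|%:R :> Q.
  by rewrite sumr_const mulNrn.
have offdiag : {in S &, forall i j, i != j -> cof M S i j = -1}.
  move=> i j iS jS ij; rewrite cof_first_step //; congr (- _).
  have jSi : j \in S :\ i by rewrite !inE eq_sym ij.
  have ltSi : (#|S :\ i| < d)%N by rewrite -(cD S).
  have [_ cofi] := IH _ ltSi.
  (* With T = S :\ i :\ j, the diagonal cofactor #|T| + 1 and the #|T| other terms, each -1, add up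
     to 1. *)
  rewrite (big_setD1 j) //= ME (negbTE ij) addr0 mul1r cof_diag //.
  have [-> _] := IH (S :\ i :\ j) (leq_trans (proper_card (properD1 jSi)) (ltnW ltSi)).
  rewrite (eq_bigr (fun=> -1)) => [|l]; last first.
    rewrite !inE => /and3P[lj li lS]; rewrite ME eq_sym (negbTE li) addr0 mul1r cofi //.
    by rewrite !inE li.
  by rewrite sumN1 -natr1 addrAC subrr add0r.
split=> //; have [->|S0] := eqVneq S set0; first by rewrite setdet0 cards0.
have [h hS ->] := setdet_cof M S0.
rewrite (big_setD1 h) //= ME eqxx cof_diag //.
have ltSh : (#|S :\ h| < d)%N by rewrite -(cD S).
have [-> _] := IH _ ltSh.
rewrite (eq_bigr (fun=> -1)) => [|l]; last first.
  by rewrite !inE => /andP[lh lS]; rewrite ME eq_sym (negbTE lh) addr0 mul1r offdiag.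
rewrite sumN1 (cD S h) // mulrDl mul1r -!natr1 -addrA.
by rewrite [X in _ + X]addrAC subrr add0r.
Qed.

(** * Cofactors of Hermitian quaternionic matrices *)

Section Conjugation.
Variable K : comNzRingType.
Implicit Types x y : quat K.

Lemma qaddE (a b c d a' b' c' d' : K) :
  Quat a b c d + Quat a' b' c' d' = Quat (a + a') (b + b') (c + c') (d + d').
Proof. by []. Qed.

Lemma qoppE (a b c d : K) : - Quat a b c d = Quat (- a) (- b) (- c) (- d).
Proof. by []. Qed.

Lemma qmulE (a b c d a' b' c' d' : K) :
  Quat a b c d * Quat a' b' c' d' =
  Quat (a * a' - b * b' - c * c' - d * d') (a * b' + b * a' + c * d' - d * c')
       (a * c' - b * d' + c * a' + d * b') (a * d' + b * c' - c * b' + d * a').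
Proof. by []. Qed.

Lemma qconj_is_zmod_morphism : zmod_morphism (@qconj K).
Proof.
by move=> [a b c d] [a' b' c' d']; rewrite /qconj !(qoppE, qaddE) /=; congr Quat; ring.
Qed.
HB.instance Definition _ :=
  GRing.isZmodMorphism.Build (quat K) (quat K) (@qconj K) qconj_is_zmod_morphism.

Lemma qconjM x y : qconj (x * y) = qconj y * qconj x.
Proof.
case: x y => [a b c d] [a' b' c' d']; rewrite /qconj /= !qmulE.
by congr Quat; ring.
Qed.

Lemma qconjN x : qconj (- x) = - qconj x. Proof. exact: raddfN. Qed.
Lemma qconjB x y : qconj (x - y) = qconj x - qconj y. Proof. exact: raddfB. Qed.
Lemma qconjMn x m : qconj (x *+ m) = qconj x *+ m. Proof. exact: raddfMn. Qed.
Lemma qconj_sum I r (P : pred I) (F : I -> quat K) :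
  qconj (\sum_(i <- r | P i) F i) = \sum_(i <- r | P i) qconj (F i).
Proof. exact: raddf_sum. Qed.

Lemma qconj1 : qconj 1 = 1 :> quat K.
Proof. by rewrite /qconj /= !oppr0. Qed.

Lemma qconjK : involutive (@qconj K).
Proof. by case=> a b c d; rewrite /qconj /= !opprK. Qed.
End Conjugation.

Section RealQuaternions.
Variable K : idomainType.
Hypothesis two_neq0 : 2%:R != 0 :> K.
Implicit Types x y : quat K.

Lemma qconj_real x : qconj x = x -> x = Quat (qa x) 0 0 0.
Proof.
have opp_fixed (a : K) : - a = a -> a = 0.
  move/eqP; rewrite -subr_eq0 -opprD oppr_eq0 -mulr2n -mulr_natl mulf_eq0 (negbTE two_neq0).
  by move/eqP.
by case: x => a b c d [/opp_fixed-> /opp_fixed-> /opp_fixed->].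
Qed.

Lemma qreal_mul (a : K) y : Quat a 0 0 0 * y = Quat (a * qa y) (a * qb y) (a * qc y) (a * qd y).
Proof. by case: y => ????; rewrite qmulE; congr Quat => /=; ring. Qed.

Lemma qreal_comm x y : qconj x = x -> x * y = y * x.
Proof.
move/qconj_real->; case: y => ????; rewrite !qmulE.
by congr Quat; ring.
Qed.

(** Quaternions over a domain may have zero divisors, but a self-conjugate one is a scalar of K and
    acts coordinatewise. *)
Lemma qreal_mul_eq0 x y : qconj x = x -> x * y = 0 -> y != 0 -> x = 0.
Proof.
move/qconj_real->; rewrite qreal_mul; move: (qa x) => a.
have [->|a0] := eqVneq a 0; first by [].
case: y => b c d e [] /eqP + /eqP + /eqP + /eqP; rewrite !mulf_eq0 (negbTE a0) /=.
by move=> /eqP-> /eqP-> /eqP-> /eqP->; rewrite eqxx.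
Qed.
End RealQuaternions.

Section Evaluation.
Variables (K : comNzRingType) (c : K).

Definition qhorner (q : quat {poly K}) : quat K :=
  Quat (qa q).[c] (qb q).[c] (qc q).[c] (qd q).[c].

Lemma qhorner_is_zmod_morphism : zmod_morphism qhorner.
Proof. by move=> [????] [????]; rewrite /qhorner /= !hornerE. Qed.

Lemma qhorner_is_monoid_morphism : monoid_morphism qhorner.
Proof.
split=> [|[????] [????]]; first by rewrite /qhorner /= !hornerE.
by rewrite /qhorner qmulE /= !hornerE.
Qed.

HB.instance Definition _ :=
  GRing.isZmodMorphism.Build (quat {poly K}) (quat K) qhorner qhorner_is_zmod_morphism.
HB.instance Definition _ :=
  GRing.isMonoidMorphism.Build (quat {poly K}) (quat K) qhorner qhorner_is_monoid_morphism.
End Evaluation.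

(** * The adjugate of a Hermitian matrix, by induction on the index set *)

Section Hermitian.
Variables (K : idomainType) (n : nat).
Hypothesis two_neq0 : 2%:R != 0 :> K.
Variable M : 'I_n -> 'I_n -> quat K.
Hypothesis hermM : forall i j, qconj (M i j) = M j i.
Implicit Types S : {set 'I_n}.

(** The invariant of the induction. Its last clause contains the independence of the row: the
    diagonal entry is the same at every j. *)
Definition adjugate_spec S : Prop :=
  [/\ qconj (setdet M S) = setdet M S,
      {in S &, forall i j, qconj (cof M S i j) = cof M S j i} &
      {in S &, forall l j, \sum_(k in S) M l k * cof M S k j = setdet M S *+ (l == j)}].

(** First-step expansions on both sides, with [cof M (S :\ i) l j] read from its end by induction,
    give the same double sum over S :\ i :\ j. The two remaining terms agree because the determinant
    over that set is real, hence central. *)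
Lemma cof_last_step S : (forall T : {set 'I_n}, T \proper S -> adjugate_spec T) ->
  {in S &, forall i j, i != j ->
     cof M S i j = - \sum_(l in S :\ j) cof M (S :\ j) i l * M l j}.
Proof.
have [d] := ubnP #|S|; elim: d S => // d IH S; rewrite ltnS => leS specS i j iS jS ij.
have jSi : j \in S :\ i by rewrite !inE eq_sym ij.
have iSj : i \in S :\ j by rewrite !inE ij.
have pSi : S :\ i \proper S by apply: properD1.
have ltSi : (#|S :\ i| < d)%N by apply: leq_trans (proper_card pSi) leS.
have eqD : S :\ i :\ j = S :\ j :\ i by rewrite !setDDl setUC.
have [realD _ _] : adjugate_spec (S :\ i :\ j).
  by apply: specS; apply: proper_trans pSi; apply: properD1.
rewrite cof_first_step // (big_setD1 j) //= [in RHS](big_setD1 i) //= !cof_diag //.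
rewrite -eqD (qreal_comm two_neq0 _ realD); congr (- (_ + _)).
transitivity (- \sum_(l in S :\ i :\ j) \sum_(l' in S :\ i :\ j)
                 M i l * cof M (S :\ i :\ j) l l' * M l' j).
  have specSi (T : {set 'I_n}) : T \proper S :\ i -> adjugate_spec T.
    by move=> pT; apply: specS; apply: proper_trans pT pSi.
  rewrite -sumrN; apply: eq_bigr => l /setD1P[lj lSi]; rewrite (IH _ ltSi specSi l j) //.
  by rewrite mulrN big_distrr; congr (- _); apply: eq_bigr => l' _; rewrite /= mulrA.
rewrite exchange_big -sumrN /=; apply: eq_bigr => l; rewrite !inE => /and3P[lj li lS].
have lSj : l \in S :\ j by rewrite !inE lj.
have il : i != l by rewrite eq_sym.
rewrite (cof_first_step M lSj iSj il) -eqD mulNr big_distrl.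
by congr (- _); apply: eq_bigr => l' _; rewrite /= mulrA.
Qed.

Section Step.
Variable S : {set 'I_n}.
Hypothesis IH : forall T : {set 'I_n}, T \proper S -> adjugate_spec T.

Lemma spec_setD1 j : j \in S -> adjugate_spec (S :\ j).
Proof. by move=> jS; apply: IH; apply: properD1. Qed.

(** Conjugation reverses products and transposes M, so it turns first-step expansions into last-step
    expansions. *)
Lemma cof_conj_step : {in S &, forall i j, qconj (cof M S i j) = cof M S j i}.
Proof.
move=> i j iS jS; have [->|ij] := eqVneq i j.
  by rewrite cof_diag //; case: (spec_setD1 jS).
rewrite cof_first_step // (cof_last_step IH) // 1?eq_sym // qconjN qconj_sum; congr (- _).
have [_ conjD _] := spec_setD1 iS.
apply: eq_bigr => l lSi; rewrite qconjM (hermM i l) conjD //.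
by rewrite !inE eq_sym ij.
Qed.

(** For T = S :\ j, reading the cofactors from their end turns the terms with k != j into minus an
    entry of M P_T M; by induction M P_T is scalar on T, so they cancel the term k = j. *)
Lemma mul_cof_offdiag : {in S &, forall l j, l != j ->
  \sum_(k in S) M l k * cof M S k j = 0}.
Proof.
move=> l j lS jS lj; have [realD _ adjD] := spec_setD1 jS.
have lSj : l \in S :\ j by rewrite !inE lj.
rewrite (big_setD1 j) //= cof_diag //; apply/eqP; rewrite addr_eq0; apply/eqP.
rewrite -sumrN; transitivity (\sum_(k in S :\ j) \sum_(k' in S :\ j)
                 M l k * cof M (S :\ j) k k' * M k' j).
  rewrite exchange_big /= (bigD1 l) //= -big_distrl /= adjD // eqxx mulr1n.
  rewrite (qreal_comm two_neq0 _ realD) big1 ?addr0 // => k' /andP[k'S k'l].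
  by rewrite -big_distrl /= adjD // eq_sym (negbTE k'l) mul0r.
apply: eq_bigr => k kSj; move: (kSj); rewrite !inE => /andP[kj kS].
rewrite (cof_last_step IH) // mulrN opprK big_distrr.
by apply: eq_bigr => k' _; rewrite /= mulrA.
Qed.

(** The row determinant at j in expanded form; its independence of j is still open at this point. *)
Let D j := \sum_(k in S) M j k * cof M S k j.

Lemma mul_cof_diag_real j : j \in S -> qconj (D j) = D j.
Proof.
move=> jS; have [realD _ _] := spec_setD1 jS; rewrite /D qconj_sum /=.
rewrite (big_setD1 j) //= [RHS](big_setD1 j) //= qconjM (hermM j j) cof_diag // realD.
rewrite (qreal_comm two_neq0 _ realD); congr (_ + _).
transitivity (- \sum_(k in S :\ j) \sum_(k' in S :\ j)
                 M j k' * cof M (S :\ j) k' k * M k j).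
  rewrite -sumrN; apply: eq_bigr => k; rewrite !inE => /andP[kj kS].
  rewrite qconjM (hermM j k) cof_conj_step // cof_first_step // 1?eq_sym // mulNr big_distrl.
  by [].
rewrite exchange_big -sumrN /=; apply: eq_bigr => k; rewrite !inE => /andP[kj kS].
rewrite (cof_last_step IH) // mulrN big_distrr; congr (- _).
by apply: eq_bigr => k' _; rewrite /= mulrA.
Qed.

Lemma mul_cofE : {in S &, forall l j, \sum_(k in S) M l k * cof M S k j = D j *+ (l == j)}.
Proof.
move=> l j lS jS; have [->|lj] := eqVneq l j; first by rewrite mulr1n.
by rewrite mulr0n mul_cof_offdiag.
Qed.

Lemma cof_mulE : {in S &, forall i l, \sum_(k in S) cof M S i k * M k l = D i *+ (i == l)}.
Proof.
move=> i l iS lS; transitivity (qconj (D i *+ (l == i))); last first.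
  by rewrite qconjMn mul_cof_diag_real // eq_sym.
rewrite -mul_cofE // qconj_sum; apply: eq_bigr => k kS.
by rewrite qconjM (hermM l k) cof_conj_step.
Qed.

(** By associativity, entry (i, j) of P M P is both D i and D j times the cofactor, so the real D i
    - D j annihilates a nonzero cofactor. *)
Lemma mul_cof_diag_eq : {in S &, forall i j, cof M S i j != 0 -> D i = D j}.
Proof.
move=> i j iS jS cof_neq0; apply/eqP; rewrite -subr_eq0; apply/eqP.
apply: (qreal_mul_eq0 two_neq0 _ _ cof_neq0).
  by rewrite qconjB !mul_cof_diag_real.
rewrite mulrBl (qreal_comm two_neq0 (cof M S i j) (mul_cof_diag_real jS)).
apply/eqP; rewrite subr_eq0; apply/eqP.
transitivity (\sum_(l in S) (\sum_(k in S) cof M S i k * M k l) * cof M S l j).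
  rewrite (bigD1 i) //= cof_mulE // eqxx mulr1n big1 ?addr0 // => l /andP[lS li].
  by rewrite cof_mulE // eq_sym (negbTE li) mul0r.
transitivity (\sum_(k in S) cof M S i k * (\sum_(l in S) M k l * cof M S l j)).
  under eq_bigr do rewrite big_distrl; rewrite exchange_big /=.
  apply: eq_bigr => k kS; rewrite big_distrr; apply: eq_bigr => l lS.
  by rewrite /= mulrA.
rewrite (bigD1 j) //= mul_cofE // eqxx mulr1n big1 ?addr0 // => k /andP[kS kj].
by rewrite mul_cofE // (negbTE kj) mulr0.
Qed.
End Step.

Lemma adjugate_spec_generic :
    (forall (S : {set 'I_n}), {in S &, forall i j, i != j -> cof M S i j != 0}) ->
  forall S, adjugate_spec S.
Proof.
move=> generic S; have [d] := ubnP #|S|; elim: d S => // d IHd S; rewrite ltnS => leS.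
have IH (T : {set 'I_n}) : T \proper S -> adjugate_spec T.
  by move=> /proper_card ltT; apply: IHd; apply: leq_trans ltT leS.
have [S0|S0] := eqVneq S set0.
  by split=> [|i j|i j]; rewrite S0 ?inE // setdet0 qconj1.
(* [setdet] is the row determinant at one index h; the nonzero off-diagonal cofactors carry its
   value to every other index. *)
have [h hS detS] := setdet_cof M S0.
have detE j : j \in S -> setdet M S = \sum_(k in S) M j k * cof M S k j.
  move=> jS; rewrite detS; have [->//|hj] := eqVneq h j.
  by apply: mul_cof_diag_eq => //; apply: generic.
split; last 2 first.
- exact: cof_conj_step.
- by move=> l j lS jS; rewrite mul_cofE // (detE j).
by rewrite detS mul_cof_diag_real.
Qed.
End Hermitian.

Lemma hermitian_adjugate (K : idomainType) n (M : 'I_n -> 'I_n -> quat K) :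
    2%:R != 0 :> K -> (forall i j, qconj (M i j) = M j i) ->
  forall S : {set 'I_n}, adjugate_spec M S.
Proof.
move=> two_neq0 hermM S.
(* Deform M, through Hermitian matrices, into I plus the all-ones matrix. *)
pose M0 (i j : 'I_n) : K := 1 + (i == j)%:R.
pose Mt (i j : 'I_n) : quat {poly K} :=
  Quat ((M0 i j)%:P + 'X * (qa (M i j) - M0 i j)%:P)
       ('X * (qb (M i j))%:P) ('X * (qc (M i j))%:P) ('X * (qd (M i j))%:P).
have Mt0 i j : qhorner 0 (Mt i j) = 1 + (i == j)%:R.
  have -> : (i == j)%:R = Quat (i == j)%:R 0 0 0 :> quat K by case: (i == j).
  rewrite -[RHS]/(Quat (1 + (i == j)%:R) (0 + 0) (0 + 0) (0 + 0)) !addr0.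
  by rewrite /qhorner /= !hornerE.
have Mt1 i j : qhorner 1 (Mt i j) = M i j.
  rewrite /qhorner /Mt /M0; case: (M i j) => a b c d /=; rewrite !hornerE /=.
  by congr Quat; ring.
have hermMt i j : qconj (Mt i j) = Mt j i.
  rewrite /Mt /qconj /= -(hermM i j) /M0 eq_sym /=.
  by rewrite !polyCN !mulrN.
have two_neq0' : 2%:R != 0 :> {poly K}.
  by rewrite -polyC_natr polyC_eq0.
(* At X = 0 every off-diagonal cofactor of [Mt] is -1, so none is zero; the resulting identities are
   then evaluated at X = 1. *)
have [|real_det conj_cof mul_cof] := adjugate_spec_generic two_neq0' hermMt _ S.
  move=> T i j iT jT ij; apply/eqP => /(congr1 (qhorner 0)); rewrite rmorph_cof rmorph0.
  have [_ cofN1] := cof_one_plus_ones T Mt0; rewrite cofN1 //.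
  by move/eqP; rewrite oppr_eq0 oner_eq0.
have evalF : qhorner 1 (setdet Mt S) = setdet M S.
  by rewrite rmorph_setdet; apply: eq_setdet; exact: Mt1.
have evalP i j : qhorner 1 (cof Mt S i j) = cof M S i j.
  by rewrite rmorph_cof; apply: eq_cof; exact: Mt1.
have evalC (x : quat {poly K}) : qhorner 1 (qconj x) = qconj (qhorner 1 x).
  by rewrite /qhorner /qconj /= !hornerN.
split.
- by rewrite -evalF -evalC real_det.
- by move=> i j iS jS; rewrite -!evalP -evalC conj_cof.
move=> l j lS jS; rewrite -evalF -rmorphMn -mul_cof // rmorph_sum.
by apply: eq_bigr => k kS; rewrite rmorphM /= evalP Mt1.
Qed.

(** * Gram matrices and the Moore-Penrose inverse *)

Lemma sum_setD1 (V : nmodType) (T : finType) (k : nat) (i : T) (f : {set T} -> V) (P : pred {set T}) :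
  \sum_(B : {set T} | [&& #|B| == k.+1, i \in B & P (B :\ i)]) f (B :\ i)
  = \sum_(B : {set T} | [&& #|B| == k, i \notin B & P B]) f B.
Proof.
rewrite [RHS](reindex_onto (fun B => B :\ i) (fun B => i |: B)) /=; last first.
  by move=> B /and3P[_ iB _]; rewrite setU1K.
apply: eq_bigl => B; rewrite setD11 /=; have [iB|iB] := boolP (i \in B).
  by rewrite setD1K // eqxx andbT (cardsD1 i B) iB.
rewrite andbF; symmetry; apply/negbTE; rewrite !negb_and; apply/orP; right.
by apply: contra iB => /eqP <-; rewrite setU11.
Qed.

(** * Sums of principal minors and of padded cofactor matrices *)

Section CompoundAdjugates.
Variables (R : realType).

Lemma two_neq0 : 2%:R != 0 :> R. Proof. by rewrite pnatr_eq0. Qed.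

Lemma ctrK m n : cancel (@ctr R m n) (@ctr R n m).
Proof. by move=> A; apply/matrixP => i j; rewrite !mxE qconjK. Qed.

Lemma ctrM m n p (A : 'M[H R]_(m, n)) (B : 'M[H R]_(n, p)) :
  ctr (A *m B) = ctr B *m ctr A.
Proof.
apply/matrixP => i j; rewrite !mxE qconj_sum; apply: eq_bigr => k _.
by rewrite !mxE qconjM.
Qed.

(** [minor_sum] and [adj_sum] are e_k and Q_k; for Hermitian M they obey, up to signs, the
    Faddeev-LeVerrier recursion. *)
Definition minor_sum n (M : 'M[H R]_n) k : H R := \sum_(S : {set 'I_n} | #|S| == k) setdet M S.
Definition adj_sum n (M : 'M[H R]_n) k : 'M[H R]_n :=
  \matrix_(i, j) \sum_(S : {set 'I_n} | [&& #|S| == k, i \in S & j \in S]) cof M S i j.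

Section HermitianMatrix.
Variables (n : nat) (M : 'M[H R]_n).
Implicit Types S : {set 'I_n}.
Hypothesis hermM : ctr M = M.

Lemma herm_entry i j : qconj (M i j) = M j i.
Proof. by rewrite -[in RHS]hermM !mxE. Qed.

Lemma setdet_real S : qconj (setdet M S) = setdet M S.
Proof. by case: (hermitian_adjugate two_neq0 herm_entry S). Qed.

Lemma cof_conj S : {in S &, forall i j, qconj (cof M S i j) = cof M S j i}.
Proof. by case: (hermitian_adjugate two_neq0 herm_entry S). Qed.

Lemma mul_cof S :
  {in S &, forall l j, \sum_(k in S) M l k * cof M S k j = setdet M S *+ (l == j)}.
Proof. by case: (hermitian_adjugate two_neq0 herm_entry S). Qed.

Lemma cof_mul S :
  {in S &, forall i l, \sum_(k in S) cof M S i k * M k l = setdet M S *+ (i == l)}.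
Proof.
move=> i l iS lS; rewrite -setdet_real -qconjMn eq_sym -mul_cof // qconj_sum.
by apply: eq_bigr => k kS; rewrite qconjM (herm_entry l k) cof_conj.
Qed.

Lemma minor_sum_real k : qconj (minor_sum M k) = minor_sum M k.
Proof. by rewrite qconj_sum; apply: eq_bigr => S _; apply: setdet_real. Qed.

Lemma adj_sum_herm k : ctr (adj_sum M k) = adj_sum M k.
Proof.
apply/matrixP => i j; rewrite !mxE qconj_sum; apply: eq_big => [S|S /and3P[_ jS iS]].
  by rewrite [(j \in S) && _]andbC.
exact: cof_conj.
Qed.

Lemma minor_sum0 : minor_sum M 0 = 1.
Proof.
rewrite /minor_sum (big_pred1 set0) ?setdet0 // => S; exact: cards_eq0.
Qed.

Lemma adj_sum0 : adj_sum M 0 = 0.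
Proof.
apply/matrixP => i j; rewrite !mxE big_pred0 // => S.
by apply/negP => /and3P[/eqP/cards0_eq->]; rewrite inE.
Qed.

Lemma mul_adj_sum_entry m (C : 'M[H R]_(m, n)) k i j :
  (C *m adj_sum M k) i j =
  \sum_(S : {set 'I_n} | (#|S| == k) && (j \in S)) \sum_(l in S) C i l * cof M S l j.
Proof.
rewrite mxE; under eq_bigr do rewrite mxE big_distrr /=.
rewrite (exchange_big_dep (fun S : {set 'I_n} => (#|S| == k) && (j \in S))) /=; last first.
  by move=> l S _ /and3P[-> _ ->].
apply: eq_bigr => S /andP[kS jS]; apply: eq_bigl => l.
by rewrite kS jS andbT.
Qed.

Lemma adj_sum_mul_entry m (C : 'M[H R]_(n, m)) k i j :
  (adj_sum M k *m C) i j =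
  \sum_(S : {set 'I_n} | (#|S| == k) && (i \in S)) \sum_(l in S) cof M S i l * C l j.
Proof.
rewrite mxE; under eq_bigr do rewrite mxE big_distrl /=.
rewrite (exchange_big_dep (fun S : {set 'I_n} => (#|S| == k) && (i \in S))) /=; last first.
  by move=> l S _ /and3P[-> -> _].
apply: eq_bigr => S /andP[kS iS]; apply: eq_bigl => l.
by rewrite kS iS.
Qed.

(** In row i, [mul_cof] settles the sets containing i. A k-set without i is a (k+1)-set with i
    deleted, and [cof_diag] or [cof_first_step] matches it with a term of the next [adj_sum]. *)
Lemma mul_adj_sum k : M *m adj_sum M k + adj_sum M k.+1 = (minor_sum M k)%:M.
Proof.
apply/matrixP => i j; rewrite [LHS]mxE mul_adj_sum_entry [X in _ + X]mxE [RHS]mxE.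
have [<-{j}|ij] := eqVneq i j.
  rewrite mulr1n /minor_sum [RHS](bigID (fun S : {set 'I_n} => i \in S)) /=; congr (_ + _).
    by apply: eq_bigr => S /andP[_ iS]; rewrite mul_cof // eqxx.
  transitivity (\sum_(S : {set 'I_n} | [&& #|S| == k, i \notin S & true]) setdet M S).
    rewrite -(sum_setD1 k i (setdet M) predT).
    by apply: eq_big => [S|S /and3P[_ iS _]]; rewrite ?andbT ?andbb // cof_diag.
  by apply: eq_bigl => S; rewrite andbT.
rewrite mulr0n (bigID (fun S : {set 'I_n} => i \in S)) /= big1 ?add0r; last first.
  by move=> S /andP[/andP[_ jS] iS]; rewrite mul_cof // (negbTE ij).
pose f (S : {set 'I_n}) := \sum_(l in S) M i l * cof M S l j.
apply/eqP; rewrite addr_eq0 -sumrN; apply/eqP.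
transitivity (\sum_(S : {set 'I_n} | [&& #|S| == k, i \notin S & j \in S]) f S).
  by apply: eq_bigl => S; rewrite -andbA [(j \in S) && _]andbC.
rewrite -(sum_setD1 k i f (fun S => j \in S)); apply: eq_big => S.
  by rewrite !inE (eq_sym j) ij.
by rewrite !inE => /and4P[_ iS _ jS]; rewrite cof_first_step // opprK.
Qed.

(** Each S contributes its determinant once per element. As in Newton's identities, this recovers
    [minor_sum] from a trace. *)
Lemma trace_mul_adj_sum k : \tr (M *m adj_sum M k) = minor_sum M k *+ k.
Proof.
rewrite /mxtrace; under eq_bigr do rewrite mul_adj_sum_entry.
rewrite (exchange_big_dep (fun S : {set 'I_n} => #|S| == k)) /=; last by move=> ? ? _ /andP[].
rewrite /minor_sum -sumrMnl; apply: eq_bigr => S /eqP kS.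
transitivity (\sum_(i in S) setdet M S); last by rewrite sumr_const kS.
apply: eq_big => [i|i /andP[_ iS]]; first by rewrite kS eqxx.
by rewrite mul_cof // eqxx.
Qed.
End HermitianMatrix.

Lemma gram_herm m n (A : 'M[H R]_(m, n)) : ctr (A *m ctr A) = A *m ctr A.
Proof. by rewrite ctrM ctrK. Qed.

Lemma mul_mx_real_scalar m n (X : 'M[H R]_(m, n)) c : qconj c = c ->
  X *m c%:M = c%:M *m X.
Proof.
move=> cR; rewrite mul_scalar_mx; apply/matrixP => i j; rewrite !mxE (bigD1 j) //= big1.
  by rewrite mxE eqxx mulr1n addr0 (qreal_comm two_neq0 _ cR).
by move=> k kj; rewrite mxE (negbTE kj) mulr0.
Qed.

Lemma qa_sum I r (P : pred I) (F : I -> H R) :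
  qa (\sum_(i <- r | P i) F i) = \sum_(i <- r | P i) qa (F i).
Proof. by elim/big_rec2: _ => // i x y _ <-. Qed.

Lemma qaMn (x : H R) k : qa (x *+ k) = qa x *+ k.
Proof. by elim: k => [|k IH]; rewrite ?mulr0n // !mulrS -IH. Qed.

(** Although quaternions do not commute, this symmetry makes the real part of a trace cyclic. *)
Lemma qa_mulC (x y : H R) : qa (x * y) = qa (y * x).
Proof. by case: x y => [????] [????]; rewrite !qmulE /=; ring. Qed.

Lemma qa_trace_mulC m n (X : 'M[H R]_(m, n)) (Y : 'M[H R]_(n, m)) :
  qa (\tr (X *m Y)) = qa (\tr (Y *m X)).
Proof.
rewrite /mxtrace !qa_sum; under eq_bigr do rewrite mxE qa_sum.
under [RHS]eq_bigr do rewrite mxE qa_sum.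
rewrite exchange_big; apply: eq_bigr => i _; apply: eq_bigr => j _; exact: qa_mulC.
Qed.

(* Row rank = column rank in disguise: as in Newton's identities, both sides are determined by
   the traces of the powers of the two Gram matrices, which have equal real parts. *)
Lemma gram_swap m n (A : 'M[H R]_(m, n)) k :
  minor_sum (A *m ctr A) k = minor_sum (ctr A *m A) k /\
  ctr A *m adj_sum (A *m ctr A) k = adj_sum (ctr A *m A) k *m ctr A.
Proof.
have hermM := gram_herm A.
have hermM' : ctr (ctr A *m A) = ctr A *m A by rewrite ctrM ctrK.
elim: k => [|k [IHe IHq]]; first by rewrite !minor_sum0 !adj_sum0 mulmx0 mul0mx.
have recE p (M : 'M[H R]_p) : ctr M = M ->
    adj_sum M k.+1 = (minor_sum M k)%:M - M *m adj_sum M k.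
  by move=> hM; rewrite -(mul_adj_sum hM) addrAC subrr add0r.
have adjE : ctr A *m adj_sum (A *m ctr A) k.+1 = adj_sum (ctr A *m A) k.+1 *m ctr A.
  rewrite !recE // mulmxBr mulmxBl mul_mx_real_scalar ?minor_sum_real // IHe; congr (_ - _).
  by rewrite -!mulmxA IHq.
split=> //; rewrite (qconj_real two_neq0 (minor_sum_real hermM k.+1)).
rewrite (qconj_real two_neq0 (minor_sum_real hermM' k.+1)); congr Quat.
apply: (@pmulrnI R k.+1) => //; rewrite -!qaMn -!trace_mul_adj_sum //.
by rewrite -!mulmxA adjE [RHS]qa_trace_mulC !mulmxA.
Qed.

Lemma mulq_conj (x : H R) : x * qconj x = Quat (qnorm2 x) 0 0 0.
Proof. by case: x => a b c d; rewrite /qconj qmulE /qnorm2 /=; congr Quat; ring. Qed.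

Lemma qnorm2_ge0 (x : H R) : 0 <= qnorm2 x.
Proof. by rewrite /qnorm2 !addr_ge0 ?sqr_ge0. Qed.

Lemma qnorm2_eq0 (x : H R) : (qnorm2 x == 0) = (x == 0).
Proof.
apply/idP/eqP => [|->]; last by rewrite /qnorm2 /= expr0n /= !addr0.
case: x => a b c d; rewrite /qnorm2 /= !paddr_eq0 ?addr_ge0 ?sqr_ge0 // !sqrf_eq0.
by move=> /andP[/andP[/andP[/eqP-> /eqP->] /eqP->] /eqP->].
Qed.

(** * Positivity of Gram determinants *)

Section Gram.
Variables (m n : nat) (A : 'M[H R]_(m, n)).
Implicit Types S T : {set 'I_m}.
Let M := A *m ctr A.

(** Both sides are the Gram form at row j of P_S, evaluated once by [cof_mul] and once as a squared
    norm through M = A [ctr A]. *)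
Lemma gram_setdet S j : j \in S ->
  qa (setdet M S) * qa (setdet M (S :\ j)) =
  \sum_l qnorm2 (\sum_(k in S) cof M S j k * A k l).
Proof.
move=> jS; have hermM : ctr M = M := gram_herm A.
have <- : qa (setdet M S * setdet M (S :\ j)) = qa (setdet M S) * qa (setdet M (S :\ j)).
  by rewrite [in LHS](qconj_real two_neq0 (setdet_real hermM S)) qreal_mul.
rewrite -[setdet M (S :\ j)](cof_diag M jS) -(cof_conj hermM jS jS).
transitivity (qa (\sum_(k in S) (\sum_(i in S) cof M S j i * M i k) * qconj (cof M S j k))).
  congr qa; rewrite (bigD1 j) //= cof_mul // eqxx mulr1n big1 ?addr0 // => k /andP[kS kj].
  by rewrite cof_mul // eq_sym (negbTE kj) mul0r.
transitivity (qa (\sum_l (\sum_(i in S) cof M S j i * A i l)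
                         * qconj (\sum_(k in S) cof M S j k * A k l))).
  congr qa; under [RHS]eq_bigr do rewrite qconj_sum big_distrr /=.
  rewrite [RHS]exchange_big /=; apply: eq_bigr => k kS.
  under [RHS]eq_bigr do rewrite qconjM mulrA.
  rewrite -big_distrl /=; congr (_ * _).
  under [RHS]eq_bigr do rewrite big_distrl /=.
  rewrite exchange_big /=; apply: eq_bigr => i iS.
  rewrite mxE big_distrr; apply: eq_bigr => l _.
  by rewrite /= !mxE mulrA.
by rewrite qa_sum; apply: eq_bigr => l _; rewrite mulq_conj.
Qed.

Definition rows_indep S := forall v : 'rV[H R]_m,
  (forall i, i \notin S -> v 0 i = 0) -> v *m A = 0 -> v = 0.

Lemma rows_indep_sub S T : T \subset S -> rows_indep S -> rows_indep T.
Proof.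
move=> /subsetP TS indepS v v0; apply: indepS => i iS; apply: v0.
by apply: contra iS; apply: TS.
Qed.

(** If v A = 0 then v M P_S = 0, and its entry at j is v j times the determinant. *)
Lemma setdet_neq0_rows_indep S : setdet M S != 0 -> rows_indep S.
Proof.
have hermM : ctr M = M := gram_herm A.
move=> detS v v0 vA; apply/rowP => j; rewrite mxE.
have [jS|/v0//] := boolP (j \in S).
have [//|vj] := eqVneq (v 0 j) 0; case/eqP: detS.
apply: (qreal_mul_eq0 two_neq0 (setdet_real hermM S) _ vj).
rewrite (qreal_comm two_neq0 _ (setdet_real hermM S)).
have vM l : \sum_(k in S) v 0 k * M k l = 0.
  transitivity ((v *m M) 0 l); last by rewrite mulmxA vA mul0mx mxE.
  rewrite mxE [RHS](bigID (mem S)) /= [X in _ + X]big1 ?addr0 // => k /v0->.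
  exact: mul0r.
transitivity (\sum_(k in S) v 0 k * (\sum_(l in S) M k l * cof M S l j)).
  rewrite (bigD1 j) //= mul_cof // eqxx mulr1n big1 ?addr0 // => k /andP[kS kj].
  by rewrite mul_cof // (negbTE kj) mulr0.
transitivity (\sum_(l in S) (\sum_(k in S) v 0 k * M k l) * cof M S l j).
  under eq_bigr do rewrite big_distrr /=.
  under [RHS]eq_bigr do rewrite big_distrl /=.
  by rewrite exchange_big /=; do 2![apply: eq_bigr => ? _]; rewrite mulrA.
by apply: big1 => l _; rewrite vM mul0r.
Qed.

(** By [gram_setdet], the determinant times a smaller one, positive by induction, is the squared
    norm of a combination of independent rows. *)
Lemma rows_indep_setdet_gt0 S : rows_indep S -> 0 < qa (setdet M S).
Proof.
have hermM : ctr M = M := gram_herm A.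
have [d] := ubnP #|S|; elim: d S => // d IH S; rewrite ltnS => leS indepS.
have [->|/set0Pn[j jS]] := eqVneq S set0; first by rewrite setdet0 ltr01.
have gt0 : 0 < qa (setdet M (S :\ j)).
  apply: IH; first by apply: leq_trans leS; rewrite [X in (_ < X)%N](cardsD1 j) jS.
  by apply: rows_indep_sub indepS; apply: subD1set.
rewrite -(pmulr_lgt0 _ gt0) gram_setdet //.
rewrite lt_def sumr_ge0 ?andbT => [|l _]; last exact: qnorm2_ge0.
rewrite psumr_eq0 => [|l _]; last exact: qnorm2_ge0.
apply/allP => all0.
(* Row j of P_S padded with zeros; its entry at j is the determinant over S :\ j, known to be
   positive. *)
pose v : 'rV[H R]_m := \row_k (if k \in S then cof M S j k else 0).
have /rowP/(_ j) : v = 0.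
  apply: indepS => [i iS|]; first by rewrite mxE (negbTE iS).
  apply/rowP => l; rewrite !mxE; apply/eqP; rewrite -qnorm2_eq0.
  have := all0 l (mem_index_enum _); congr (qnorm2 _ == 0).
  rewrite big_mkcond; apply: eq_bigr => k _; rewrite mxE.
  by case: ifP; rewrite ?mul0r.
rewrite !mxE jS cof_diag // => det0.
by move: gt0; rewrite det0 ltxx.
Qed.

Lemma gram_setdet_ge0 S : 0 <= qa (setdet M S).
Proof.
have [->|/setdet_neq0_rows_indep/rows_indep_setdet_gt0/ltW//] := eqVneq (setdet M S) 0.
exact: lexx.
Qed.

Lemma minor_sum_eq0 k : minor_sum M k = 0 -> forall S, #|S| = k -> setdet M S = 0.
Proof.
have hermM : ctr M = M := gram_herm A.
move/(congr1 (@qa R)); rewrite qa_sum => /eqP.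
rewrite psumr_eq0 => [/allP all0 S cS|S _]; last exact: gram_setdet_ge0.
rewrite (qconj_real two_neq0 (setdet_real hermM S)).
by have := all0 S (mem_index_enum _); rewrite cS eqxx => /eqP->.
Qed.

(** A vanishing sum of nonnegative minors vanishes termwise, and then [gram_setdet] makes every row
    of P_S A zero. *)
Lemma adj_sum_mul_eq0 k : minor_sum M k = 0 -> adj_sum M k *m A = 0.
Proof.
move=> /minor_sum_eq0 det0; apply/matrixP => i j; rewrite adj_sum_mul_entry mxE.
apply: big1 => S /andP[/eqP cS iS]; apply/eqP; rewrite -qnorm2_eq0.
have /eqP := gram_setdet iS; rewrite det0 // mul0r eq_sym psumr_eq0 => [/allP all0|l _].
  by have := all0 j (mem_index_enum _).
exact: qnorm2_ge0.
Qed.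
End Gram.

(** * Rank and the Moore-Penrose inverse *)

Lemma cols_indepE m n (A : 'M[H R]_(m, n)) (S : {set 'I_n}) :
  cols_indep A S <-> rows_indep (ctr A) S.
Proof.
have ctr0 p q : ctr (0 : 'M[H R]_(p, q)) = 0.
  by apply/matrixP => i j; rewrite !mxE /qconj /= !oppr0.
split=> indep v v0 Av.
  rewrite -[v]ctrK; apply/eqP; rewrite -[0]ctrK ctr0; apply/eqP; congr ctr; apply: indep.
    by move=> j jS; rewrite !mxE v0 // /qconj /= !oppr0.
  by rewrite -[A]ctrK -ctrM Av ctr0.
rewrite -[v]ctrK; apply/eqP; rewrite -[0]ctrK ctr0; apply/eqP; congr ctr; apply: indep.
  by move=> j jS; rewrite !mxE v0 // /qconj /= !oppr0.
by rewrite -ctrM Av ctr0.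
Qed.

(** [has_rank] counts columns, while minors of A [ctr A] select rows; [gram_swap] passes to [ctr A]
    A. There an independent k-set gives a positive term, and no (k+1)-set is independent. *)
Lemma has_rank_minor_sum m n (A : 'M[H R]_(m, n)) k : has_rank A k ->
  0 < qa (minor_sum (A *m ctr A) k) /\ minor_sum (A *m ctr A) k.+1 = 0.
Proof.
case=> [[S [cS indepS]] maxS]; have [-> _] := gram_swap A k; have [-> _] := gram_swap A k.+1.
have Mt : ctr A *m A = ctr A *m ctr (ctr A) by rewrite ctrK.
rewrite Mt; split; last first.
  apply: big1 => T /eqP cT; apply/eqP/negPn/negP => /setdet_neq0_rows_indep/cols_indepE/maxS.
  by rewrite cT ltnn.
rewrite qa_sum (bigD1 S) ?cS //=; apply: ltr_wpDr.
  by apply: sumr_ge0 => T _; apply: gram_setdet_ge0.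
by apply: rows_indep_setdet_gt0; apply/cols_indepE.
Qed.

Lemma MP_mul_minor_sum m n (A : 'M[H R]_(m, n)) (X : 'M[H R]_(n, m)) k :
  has_rank A k -> is_MP A X ->
  X *m (minor_sum (A *m ctr A) k)%:M = ctr A *m adj_sum (A *m ctr A) k.
Proof.
move=> /has_rank_minor_sum[_ /adj_sum_mul_eq0 adjA0] [AXA XAX hAX hXA].
have hermM := gram_herm A.
(* The Penrose equations give X A [ctr A] = [ctr A] and X = X [ctr X] [ctr A]; the latter kills the
   term with Q_(k+1). *)
have XM : X *m (A *m ctr A) = ctr A.
  by rewrite mulmxA -hXA -ctrM mulmxA AXA.
have XE : X = X *m ctr X *m ctr A by rewrite -mulmxA -ctrM hAX mulmxA XAX.
rewrite -(mul_adj_sum hermM) mulmxDr mulmxA XM [X in _ *m _ + X *m _]XE -mulmxA.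
have -> : ctr A *m adj_sum (A *m ctr A) k.+1 = 0.
  rewrite -(adj_sum_herm hermM) -ctrM adjA0.
  by apply/matrixP => i j; rewrite !mxE /qconj /= !oppr0.
by rewrite mulmx0 addr0.
Qed.

Lemma qinv_real (a : R) : qinv (Quat a 0 0 0) = Quat a^-1 0 0 0.
Proof.
rewrite /qinv /qnorm2 /qconj /= !oppr0 !mul0r expr0n /= !addr0; congr Quat.
(* For a = 0 both sides are 0, since inversion sends 0 to 0. *)
have [->|a0] := eqVneq a 0; first by rewrite mul0r invr0.
by rewrite expr2 invfM mulrA divff // mul1r.
Qed.

(** A Cramer rule: the numerator is an entry of C [ctr A] Q_k, that is of C X times e_k, and e_k is
    real and positive, hence central and invertible. *)
Lemma mul_MP_entry m n p (A : 'M[H R]_(m, n)) (X : 'M[H R]_(n, m)) (C : 'M[H R]_(p, n)) k i j :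
  has_rank A k -> is_MP A X ->
  (C *m X) i j =
  (\sum_(S : {set 'I_m} | (#|S| == k) && (j \in S))
      rdet_sub (row_repl (A *m ctr A) j (row i (C *m ctr A))) S j)
  * qinv (\sum_(S : {set 'I_m} | #|S| == k) hminor (A *m ctr A) S).
Proof.
move=> rkA mpA; have hermM := gram_herm A.
have -> : \sum_(S : {set 'I_m} | #|S| == k) hminor (A *m ctr A) S = minor_sum (A *m ctr A) k.
  by apply: eq_bigr => S _; apply: hminor_setdet.
have -> : \sum_(S : {set 'I_m} | (#|S| == k) && (j \in S))
      rdet_sub (row_repl (A *m ctr A) j (row i (C *m ctr A))) S j
    = (C *m ctr A *m adj_sum (A *m ctr A) k) i j.
  rewrite mul_adj_sum_entry; apply: eq_bigr => S /andP[_ jS].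
  rewrite rdet_sub_rowdet // rowdet_cof //; apply: eq_bigr => l _.
  by rewrite mxE.
rewrite -mulmxA -(MP_mul_minor_sum rkA mpA) mulmxA.
have [gt0 _] := has_rank_minor_sum rkA.
have eR := minor_sum_real hermM k.
rewrite mul_mx_real_scalar // mul_scalar_mx [in RHS]mxE (qreal_comm two_neq0 _ eR) -mulrA.
rewrite (qconj_real two_neq0 eR) qinv_real qreal_mul /= mulr0 divff ?gt_eqF //.
by rewrite -[Quat 1 0 0 0]/(1 : H R) mulr1.
Qed.
End CompoundAdjugates.

Theorem theorem5p8 (R : realType) (r s q m r1 r2 r3 : nat)
  (B1 : 'M[H R]_(r, s)) (B2 : 'M[H R]_(q, s)) (C : 'M[H R]_(m, s))
  (B1d : 'M[H R]_(s, r)) (Nd : 'M[H R]_(s, q)) :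
  has_rank B1 r1 -> has_rank B2 r2 ->
  is_MP B1 B1d ->
  let N := B2 *m LA B1d B1 in
  has_rank N r3 -> is_MP N Nd ->
  let X1 := C *m B1d - C *m Nd *m B2 *m B1d in
  let X2 := C *m Nd in
  let C1 := C *m ctr B1 in
  let C2 := C *m ctr N in
  let Bt2 := B2 *m ctr B1 in
  let BB := B1 *m ctr B1 in
  let NN := N *m ctr N in
  let d1 := \sum_(A : {set 'I_r} | #|A| == r1) hminor BB A in
  let d3 := \sum_(A : {set 'I_q} | #|A| == r3) hminor NN A in
  (forall (i : 'I_m) (j : 'I_r),
     X1 i j =
       (\sum_(A : {set 'I_r} | (#|A| == r1) && (j \in A))
           rdet_sub (row_repl BB j (row i C1)) A j) * qinv d1
     - (\sum_(t < q)
          (\sum_(A : {set 'I_q} | (#|A| == r3) && (t \in A))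
              rdet_sub (row_repl NN t (row i C2)) A t)
          * (\sum_(A : {set 'I_r} | (#|A| == r1) && (j \in A))
              rdet_sub (row_repl BB j (row t Bt2)) A j))
       * qinv (d3 * d1)) /\
  (forall (g : 'I_m) (f : 'I_q),
     X2 g f =
       (\sum_(A : {set 'I_q} | (#|A| == r3) && (f \in A))
           rdet_sub (row_repl NN f (row g C2)) A f) * qinv d3).
Proof.
move=> rk1 _ mp1 N rk3 mp3 X1 X2 C1 C2 Bt2 BB NN d1 d3.
split=> [i j|g f]; last exact: mul_MP_entry.
have d1R : qconj d1 = d1.
  by rewrite qconj_sum; apply: eq_bigr => S _; rewrite hminor_setdet setdet_real // gram_herm.
have d3R : qconj d3 = d3.
  by rewrite qconj_sum; apply: eq_bigr => S _; rewrite hminor_setdet setdet_real // gram_herm.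
have qinvR : qconj (qinv d3) = qinv d3.
  by rewrite (qconj_real (two_neq0 R) d3R) qinv_real /qconj /= !oppr0.
have -> : qinv (d3 * d1) = qinv d3 * qinv d1.
  rewrite (qconj_real (two_neq0 R) d1R) (qconj_real (two_neq0 R) d3R) qreal_mul /= !mulr0.
  by rewrite !qinv_real qreal_mul /= !mulr0 invfM.
(* The subtracted matrix is regrouped as C Nd times B2 B1d, so that the Cramer rule applies to each
   factor. *)
rewrite /X1 [LHS]mxE [X in _ + X]mxE -mulmxA; congr (_ - _); first exact: mul_MP_entry.
rewrite mxE big_distrl; apply: eq_bigr => t _ /=.
rewrite (mul_MP_entry _ _ _ rk3 mp3) (mul_MP_entry _ _ _ rk1 mp1) -!mulrA; congr (_ * _).
(* The real [qinv d3] is central and moves past the second numerator. *)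
by rewrite mulrA (qreal_comm (two_neq0 R) _ qinvR) -mulrA.
Qed.
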